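(* Let $(X,d)$ be a complete CAT$(0)$ space and suppose $T_1,T_2:X\to X$ satisfy property $(P_2)$. Let $(\varepsilon_n)$ and $(\delta_n)$ be sequences of nonnegative reals with $\sum_{n=0}^\infty\varepsilon_n<\infty$ and $\sum_{n=0}^\infty\delta_n<\infty$. Given any starting point $x_0\in X$, let $(x_n)$ (starting at $x_0$) and $(y_n)$ be any sequences in $X$ satisfying $$d(y_n,T_1x_n)\le\varepsilon_n\quad\text{and}\quad d(x_{n+1},T_2y_n)\le\delta_n\quad\text{for each }n\in\mathbb{N}.$$ Then: (i) if $\mathrm{Fix}(T_2\circ T_1)=\emptyset$, then $(x_n)$ and $(y_n)$ are unbounded; (ii) if $\mathrm{Fix}(T_2\circ T_1)\neq\emptyset$, then there exists $u\in\mathrm{Fix}(T_2\circ T_1)$ such that $(x_n)$ and $(y_n)$ $\Delta$-converge to $u$ and $T_1u$, respectively. If, in addition, the image of $T_1$ or of $T_2$ is boundedly compact, then the convergence is strong (i.e. in the metric $d$).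
   Context: $\mathbb{N}=\{0,1,2,\ldots\}$; $\mathrm{Fix}(T)$ is the set of fixed points of $T$. $T:X\to X$ satisfies property $(P_2)$ iff $2d(Tx,Ty)^2\le d(x,Ty)^2+d(y,Tx)^2-d(x,Tx)^2-d(y,Ty)^2$ for all $x,y\in X$. A CAT$(0)$ space is a geodesic space of nonpositive curvature in the sense of Alexandrov; equivalently, a geodesic space such that for all $x,y,z$, all $t\in[0,1]$ and every point $m$ on a geodesic segment from $x$ to $y$ with $d(m,x)=t\,d(x,y)$, one has $d(z,m)^2\le(1-t)d(z,x)^2+t\,d(z,y)^2-t(1-t)d(x,y)^2$. For a bounded sequence $(x_n)$ in $X$, an asymptotic center is a point $x\in X$ with $\limsup_n d(x,x_n)=\inf_{y\in X}\limsup_n d(y,x_n)$. A bounded sequence $(x_n)$ $\Delta$-converges to $x\in X$ iff $x$ is the unique asymptotic center of every subsequence of $(x_n)$. As usual, a set is boundedly compact iff each of its bounded closed subsets is compact, i.e. every bounded sequence in it has a subsequence converging to a point of the set. *)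

(* Defs.v *)
From HB Require Import structures.
From mathcomp Require Import all_boot all_order all_algebra.
From mathcomp Require Import all_classical all_reals all_analysis.

Set Implicit Arguments.
Unset Strict Implicit.
Unset Printing Implicit Defensive.

Import Order.TTheory GRing.Theory Num.Theory.
Import numFieldNormedType.Exports.

Local Open Scope classical_set_scope.
Local Open Scope ring_scope.

#[short(type="completeMetricType")]
HB.structure Definition CompleteMetric (R : numDomainType) :=
  {T of Metric R T & Complete T}.

Section defs.
Context {R : realType} {X : metricType R}.
Implicit Types (A : set X) (u : nat -> X) (T : X -> X).

Definition Fix T : set X := [set x | T x = x].

Definition property_P2 T := forall x y : X,
  2 * mdist (T x) (T y) ^+ 2 <=
    mdist x (T y) ^+ 2 + mdist y (T x) ^+ 2
    - mdist x (T x) ^+ 2 - mdist y (T y) ^+ 2.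

(* Only the values of [c] on [0, mdist x y] matter. *)
Definition geodesic (x y : X) (c : R -> X) :=
  [/\ c 0 = x, c (mdist x y) = y &
      {in `[0, mdist x y] &, forall s t, mdist (c s) (c t) = `|s - t|}].

Definition geodesic_segment (x y : X) (S : set X) :=
  exists2 c, geodesic x y c & S = c @` `[0, mdist x y].

Definition bounded_subset A :=
  exists M : R, forall x y, A x -> A y -> mdist x y <= M.

Definition asymptotic_center u (x : X) :=
  limn_esup (fun n => (mdist x (u n))%:E) =
  ereal_inf (range (fun y => limn_esup (fun n => (mdist y (u n))%:E))).

Definition Delta_cvg u (x : X) :=
  bounded_subset (range u) /\
  forall phi : nat -> nat, increasing_seq phi ->
    asymptotic_center (u \o phi) = [set x].

(* Closedness of the bounded closed subsets of [A] is relative to [A]: the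
   limit of the subsequence has to lie in [A]. *)
Definition boundedly_compact A :=
  forall u, (forall n, A (u n)) -> bounded_subset (range u) ->
    exists2 phi : nat -> nat, increasing_seq phi &
      exists2 l : X, A l & (u \o phi) @ \oo --> l.

End defs.

Definition geodesic_space (R : realType) (X : metricType R) :=
  forall x y : X, exists S, geodesic_segment x y S.

Definition CAT0 (R : realType) (X : metricType R) :=
  geodesic_space X /\
  forall (x y z m : X) (S : set X) (t : R),
    geodesic_segment x y S -> S m ->
    0 <= t <= 1 -> mdist m x = t * mdist x y ->
    mdist z m ^+ 2 <= (1 - t) * mdist z x ^+ 2 + t * mdist z y ^+ 2
                      - t * (1 - t) * mdist x y ^+ 2.

(* Main.v *)
(** Put [U = T2 \o T1].  Applying property (P2) to [T1] and to [T2] and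
bounding the four mixed terms with the Berg-Nikolaev inequality gives
[2 d(U p, U q) <= d(p, U q) + d(q, U p)].  Along a bounded orbit the limits
[rho_k = lim_n d(U^n w, U^(n+k) w)] are therefore convex in [k]; as they are
bounded and [rho_0 = 0], [rho_1 = 0], so [U] is asymptotically regular.  A
sequence with summable errors is shadowed from index [m] on by the exact orbit
of its [m]-th term, up to the tail of the error series, so it is asymptotically
regular as well.  Its asymptotic center, which exists and is unique by
completeness and the CAT(0) inequality, is then a fixed point of [U], and
Opial's argument together with the Fejer monotonicity up to summable errors
gives Delta-convergence. *)

Require Import Defs.
From mathcomp Require Import all_boot all_order all_algebra.
From mathcomp Require Import all_classical all_reals all_analysis.
From mathcomp Require Import ring lra.
Set Implicit Arguments.
Unset Strict Implicit.
Unset Printing Implicit Defensive.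

Import Order.TTheory GRing.Theory Num.Theory.
Import numFieldNormedType.Exports.
Local Open Scope classical_set_scope.
Local Open Scope ring_scope.

(** * Four-point inequalities in CAT(0) spaces and property (P2) *)

Section CAT0_geometry.
Context {R : realType} {X : metricType R}.
Hypothesis hX : CAT0 X.
Implicit Types (a b c e p q x y z m : X) (T U : X -> X).

Lemma CAT0_geodesic_point x y (t : R) : 0 <= t <= 1 ->
  exists m, forall z, mdist z m ^+ 2 <=
    (1 - t) * mdist z x ^+ 2 + t * mdist z y ^+ 2
    - t * (1 - t) * mdist x y ^+ 2.
Proof.
move=> t01; have /andP[t0 t1] := t01.
have [S hS] := hX.1 x y; have [c [c0 c1 cd] ES] := hS.
have d0 : 0 <= mdist x y := mdist_ge0 x y.
have tin : t * mdist x y \in `[0, mdist x y].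
  by rewrite in_itv /= mulr_ge0 //= ler_piMl.
exists (c (t * mdist x y)) => z; apply: (hX.2 x y z _ S) => //.
  by rewrite ES; exists (t * mdist x y).
rewrite -{2}c0 cd //; last by rewrite in_itv /= lexx.
by rewrite subr0 ger0_norm // mulr_ge0.
Qed.

(* The Berg-Nikolaev form of the Cauchy-Schwarz inequality. *)
Lemma CAT0_quadrilateral a b c e :
  mdist a c ^+ 2 + mdist b e ^+ 2 <=
  mdist a e ^+ 2 + mdist b c ^+ 2 + 2 * mdist a b * mdist c e.
Proof.
have [->|ab] := eqVneq a b; first by rewrite mdistxx; lra.
have [->|ce] := eqVneq c e; first by rewrite mdistxx; lra.
move: ab ce; rewrite -!mdist_gt0.
set p := mdist a b; set q := mdist c e => p0 q0.
have s0 : 0 < p + q by rewrite addr_gt0.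
(* The point [m] cuts the segment from [b] to [e] in the ratio [p : q]. With this choice the [be]
   terms of [H1] and [H2] add up to exactly [- p * q * be ^+ 2], and the two sides of [H4] differ by
   the square [(q * am - p * cm) ^+ 2]. *)
have t01 : 0 <= p / (p + q) <= 1.
  by rewrite divr_ge0 ?(ltW p0) ?(ltW s0) //= ler_pdivrMr // mul1r lerDl ltW.
have [m hm] := CAT0_geodesic_point b e t01.
have ham := hm a; have hcm := hm c.
have tri : mdist a c <= mdist a m + mdist c m.
  by rewrite (metric_sym c m); exact: metric_triangle.
rewrite (metric_sym c b) -/q in hcm; rewrite -/p in ham.
have am0 := mdist_ge0 a m; have cm0 := mdist_ge0 c m; have ac0 := mdist_ge0 a c.
move: (mdist a m) (mdist c m) (mdist a c) (mdist a e) (mdist b c) (mdist b e)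
  ham hcm tri am0 cm0 ac0 => am cm ac ae bc be ham hcm tri am0 cm0 ac0.
have H1 : q * (p + q) * am ^+ 2 <=
    q * q * p ^+ 2 + q * p * ae ^+ 2 - q * p * (1 - p / (p + q)) * be ^+ 2.
  have := ler_wpM2l (ltW (mulr_gt0 q0 s0)) ham.
  congr (_ <= _); field; exact: lt0r_neq0.
have H2 : p * (p + q) * cm ^+ 2 <=
    p * q * bc ^+ 2 + p * p * q ^+ 2 - p * q * (p / (p + q)) * be ^+ 2.
  have := ler_wpM2l (ltW (mulr_gt0 p0 s0)) hcm.
  congr (_ <= _); field; exact: lt0r_neq0.
have H3 : p * q * ac ^+ 2 <= p * q * (am + cm) ^+ 2.
  rewrite ler_wpM2l ?mulr_ge0 ?(ltW p0) ?(ltW q0) // ler_pXn2r //.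
  by rewrite nnegrE addr_ge0.
have H4 : p * q * (am + cm) ^+ 2 <=
    q * (p + q) * am ^+ 2 + p * (p + q) * cm ^+ 2.
  have := sqr_ge0 (q * am - p * cm); lra.
rewrite -(ler_pM2l (mulr_gt0 p0 q0)).
move: H1 H2; set t := p / (p + q); lra.
Qed.

(** The Berg-Nikolaev inequality for [x], [y], [T y], [T x] bounds the right-hand side of (P2) by
    [2 * mdist x y * D], where [D = mdist (T x) (T y)]; a positive [D] can then be divided out. *)
Lemma P2_nonexpansive T : property_P2 T ->
  forall x y, mdist (T x) (T y) <= mdist x y.
Proof.
move=> hT x y; have := hT x y; have := CAT0_quadrilateral x y (T y) (T x).
rewrite (metric_sym (T y) (T x)).
have := mdist_ge0 (T x) (T y); have := mdist_ge0 x y.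
move: (mdist (T x) (T y)) => D xy0; rewrite le_eqVlt => /predU1P[<- //|D0] h1 h2.
rewrite -(ler_pM2l D0); lra.
Qed.

(** Let [b = mdist (T1 p) (T1 q)], let [a] be the distance after applying [T2], and [c], [e] the two
    terms on the right. Adding both (P2) inequalities to [B1] and [B2] leaves
    [a ^+ 2 + b ^+ 2 <= b * (c + e)], and [2 * a * b <= a ^+ 2 + b ^+ 2] lets a positive [b] be
    divided out. If [b = 0], then [a = 0] by nonexpansiveness. *)
Lemma P2_comp T1 T2 : property_P2 T1 -> property_P2 T2 -> forall p q,
  2 * mdist (T2 (T1 p)) (T2 (T1 q)) <=
  mdist p (T2 (T1 q)) + mdist q (T2 (T1 p)).
Proof.
move=> h1 h2 p q.
have A1 := h1 p q; have A2 := h2 (T1 p) (T1 q).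
have B1 := CAT0_quadrilateral p (T2 (T1 q)) (T1 q) (T1 p).
have B2 := CAT0_quadrilateral q (T2 (T1 p)) (T1 p) (T1 q).
have ba := P2_nonexpansive h2 (T1 p) (T1 q).
have a0 := mdist_ge0 (T2 (T1 p)) (T2 (T1 q)).
have c0 := mdist_ge0 p (T2 (T1 q)).
have e0 := mdist_ge0 q (T2 (T1 p)).
rewrite !(metric_sym (T2 _) (T1 _)) (metric_sym (T1 q) (T1 p)) in B1 B2.
move: (mdist (T1 p) (T1 q)) (mdist (T2 (T1 p)) _) (mdist p (T2 _))
  (mdist q (T2 _)) A1 A2 B1 B2 ba a0 c0 e0 => b a c e A1 A2 B1 B2 ba a0 c0 e0.
have [b0|b0] := ltP 0 b; last by lra.
rewrite -(ler_pM2l b0); have := sqr_ge0 (b - a); lra.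
Qed.

End CAT0_geometry.

(** * Boundedness and convergence expressed by distances *)

Lemma bounded_subset_rangeP {R : realType} {X : metricType R} (z : nat -> X)
    (p : X) :
  bounded_subset (range z) <-> exists M : R, forall n, mdist p (z n) <= M.
Proof.
split=> [[M hM]|[M hM]].
  exists (mdist p (z 0%N) + M) => n; have := metric_triangle p (z 0%N) (z n).
  have : mdist (z 0%N) (z n) <= M by apply: hM; [exists 0%N|exists n].
  lra.
exists (M + M) => _ _ [i _ <-] [j _ <-].
have := metric_triangle (z i) p (z j); rewrite (metric_sym (z i) p).
have := hM i; have := hM j; lra.
Qed.

Lemma cvg_mdist0 {R : realType} {X : metricType R} (z : nat -> X) (p : X) :
  mdist p (z n) @[n --> \oo] --> (0 : R) <-> z @ \oo --> p.
Proof.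
split=> [/cvgrPdist_le|/metricType_numDomainType.cvgrPdist_le] h.
  apply/metricType_numDomainType.cvgrPdist_le => eta /h; apply: filterS => n.
  by rewrite sub0r normrN ger0_norm ?mdist_ge0.
apply/cvgrPdist_le => eta /h; apply: filterS => n.
by rewrite sub0r normrN ger0_norm ?mdist_ge0.
Qed.

Lemma cvg_mdist_le {R : realType} {X Y : metricType R} (z : nat -> X)
    (w : nat -> Y) (p : X) (q : Y) (e : nat -> R) :
  (forall n, mdist q (w n) <= mdist p (z n) + e n) ->
  e @ \oo --> (0 : R) -> z @ \oo --> p -> w @ \oo --> q.
Proof.
move=> h e0 /cvg_mdist0 zp; apply/cvg_mdist0.
apply: (@squeeze_cvgr _ _ _ _ (cst 0) (fun n => mdist p (z n) + e n)).
- by apply: nearW => n; rewrite mdist_ge0 h.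
- exact: cvg_cst.
- by rewrite -[0]addr0; exact: cvgD.
Qed.

Lemma increasing_seq_cvg_infty (phi : nat -> nat) :
  increasing_seq phi -> phi @ \oo --> \oo.
Proof.
move=> /increasing_seqP hphi.
have lephi n : (n <= phi n)%N.
  by elim: n => // n ih; exact: leq_ltn_trans ih (hphi n).
move=> A [N _ hN]; exists N => // n /= Nn.
by apply: hN => /=; exact: leq_trans (lephi n).
Qed.

(** * Asymptotic regularity of exact and inexact orbits *)

Section inexact_orbits.
Context {R : realType} {X : metricType R}.
Variable U : X -> X.
Hypothesis U_nonexp : forall p q : X, mdist (U p) (U q) <= mdist p q.
Hypothesis U_mid :
  forall p q : X, 2 * mdist (U p) (U q) <= mdist p (U q) + mdist q (U p).

Lemma nonexpansive_iter n (p q : X) :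
  mdist (iter n U p) (iter n U q) <= mdist p q.
Proof. by elim: n => //= n ih; exact: le_trans ih. Qed.

Lemma bounded_orbit_regular (w : X) (M : R) :
  (forall n, mdist w (iter n U w) <= M) ->
  mdist (iter n U w) (iter n.+1 U w) @[n --> \oo] --> (0 : R).
Proof.
move=> hM; pose a k n : R := mdist (iter n U w) (iter (n + k) U w).
have a_ge0 k n : 0 <= a k n by exact: mdist_ge0.
have a_dec k : nonincreasing_seq (a k).
  by apply/nonincreasing_seqP => n; rewrite /a addSn !iterS; exact: U_nonexp.
have a_cvg k : cvgn (a k).
  by apply: nonincreasing_is_cvgn => //; exists 0 => _ [n _ <-].
pose rho k := limn (a k).
have rho_ge0 k : 0 <= rho k by apply: limr_ge => //; exact: nearW.
have rho_le k : rho k <= M.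
  apply: le_trans (nonincreasing_cvgn_ge (a_dec k) (a_cvg k) 0%N) _.
  exact: hM.
(* At [U^n w] and [U^(n+k+1) w], [U_mid] bounds [2 * a k.+1 n.+1] by [a k.+2 n + a k n.+1]; hence
   the shifted limit [cS]. *)
have rho_mid k : 2 * rho k.+1 <= rho k.+2 + rho k.
  have cS : a k n.+1 @[n --> \oo] --> rho k.
    by rewrite (@cvg_shiftS _ (a k)); exact: a_cvg.
  rewrite -(cvg_lim _ (cvgD (a_cvg k.+2) cS)) //.
  apply: limr_ge; first by apply: is_cvgD; [exact: a_cvg | exact: cvgP cS].
  apply: nearW => n /=.
  have := nonincreasing_cvgn_ge (a_dec k.+1) (a_cvg k.+1) n.+1.
  have := U_mid (iter n U w) (iter (n + k.+1) U w).
  rewrite -!iterS (metric_sym (iter (n + k.+1) U w)) /rho /a !fctE !addSn !addnS.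
  by lra.
have rho_step k : rho 1%N - rho 0%N <= rho k.+1 - rho k.
  by elim: k => // k ih; have := rho_mid k; lra.
have rho_lin k : k%:R * (rho 1%N - rho 0%N) <= rho k.
  elim: k => [|k ih]; first by rewrite mul0r.
  by have := rho_step k; rewrite -natr1 mulrDl; lra.
have rho0 : rho 0%N <= 0.
  apply: le_trans (nonincreasing_cvgn_ge (a_dec 0%N) (a_cvg 0%N) 0%N) _.
  by rewrite /a mdistxx.
(* A positive first increment would, by [rho_lin], push [rho k] beyond its bound [M] once [k]
   exceeds [M] divided by that increment. *)
have rho1 : rho 1%N = 0.
  apply/eqP; rewrite eq_le rho_ge0 andbT leNgt; apply/negP => r1.
  have r10 : 0 < rho 1%N - rho 0%N by lra.
  have := rho_lin (Num.bound (M / (rho 1%N - rho 0%N))).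
  have M0 : 0 <= M / (rho 1%N - rho 0%N).
    by rewrite divr_ge0 ?(ltW r10) // (le_trans _ (rho_le 0%N)).
  have := archi_boundP M0; rewrite ltr_pdivrMr // => h1 h2.
  by have := rho_le (Num.bound (M / (rho 1%N - rho 0%N))); lra.
rewrite -rho1; have -> : (fun n => mdist (iter n U w) (iter n.+1 U w)) = a 1%N.
  by apply/funext => n; rewrite /a addn1.
exact: a_cvg.
Qed.

Variables (z : nat -> X) (e : nat -> R).
Hypothesis e_ge0 : forall n, 0 <= e n.
Hypothesis e_cvg : cvgn (series e).
Hypothesis hz : forall n, mdist (z n.+1) (U (z n)) <= e n.

Let series_le n : series e n <= limn (series e).
Proof.
by apply: nondecreasing_cvgn_le => //; apply: nondecreasing_series => k _ _.
Qed.

Let series_ge0 n : 0 <= series e n.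
Proof. by rewrite /series /=; apply: sumr_ge0 => i _. Qed.

(** Each step adds one new error, and [U] does not enlarge the deviation accumulated so far, so the
    errors simply add up. *)
Lemma inexact_orbit_shadow m j :
  mdist (z (m + j)%N) (iter j U (z m)) <= series e (m + j)%N - series e m.
Proof.
elim: j => [|j ih]; first by rewrite addn0 mdistxx subrr.
rewrite addnS iterS seriesSr.
have := metric_triangle (z (m + j).+1%N) (U (z (m + j)%N)) (U (iter j U (z m))).
have := U_nonexp (z (m + j)%N) (iter j U (z m)); have := hz (m + j)%N; lra.
Qed.

Lemma inexact_orbit_regular : bounded_subset (range z) ->
  mdist (z n) (U (z n)) @[n --> \oo] --> (0 : R).
Proof.
move=> bz; apply/cvgrPdist_le => /= eta eta0.
(* Three quarters are spent: one on the distance from [z n] to the shadowing point [w], one on the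
   same distance after applying [U], and one on [mdist w (U w)]. *)
have eta4 : 0 < eta / 4 by rewrite divr_gt0.
have /cvgrPdist_le/(_ _ eta4)[m _ /(_ m (leqnn m)) /= hm] := e_cvg.
have tail j : mdist (z (m + j)%N) (iter j U (z m)) <= eta / 4.
  apply: le_trans (inexact_orbit_shadow m j) _.
  apply: le_trans (le_trans (ler_norm _) hm).
  by rewrite lerB.
have [M hM] := (bounded_subset_rangeP z (z m)).1 bz.
have hw n : mdist (z m) (iter n U (z m)) <= M + eta / 4.
  have := metric_triangle (z m) (z (m + n)%N) (iter n U (z m)).
  by have := hM (m + n)%N; have := tail n; lra.
have /cvgrPdist_le/(_ _ eta4)[N _ hN] := bounded_orbit_regular hw.
exists (m + N)%N => // n /= mNn.
have mn : (m <= n)%N by apply: leq_trans mNn; exact: leq_addr.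
have := hN (n - m)%N; rewrite /= leq_subRL // => /(_ mNn).
rewrite sub0r normrN ger0_norm ?mdist_ge0 // => h1.
rewrite sub0r normrN ger0_norm ?mdist_ge0 //.
have := tail (n - m)%N; rewrite subnKC //.
set w := iter _ U (z m) in h1 * => h2.
have := metric_triangle (z n) w (U (z n)); have := metric_triangle w (U w) (U (z n)).
have := U_nonexp w (z n); rewrite (metric_sym w (z n)); lra.
Qed.

(** Subtracting the partial error sums makes the distance to a fixed point nonincreasing, and it
    stays above minus the total error. So the difference converges, and adding the sums back keeps
    convergence. *)
Lemma inexact_orbit_fejer p : Fix U p -> cvgn (fun n => mdist p (z n)).
Proof.
move=> Up; pose f := (fun n => mdist p (z n)) - series e.
have -> : (fun n => mdist p (z n)) = f + series e by rewrite subrK.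
have fE n : f n = mdist p (z n) - series e n by [].
apply: is_cvgD => //; apply: nonincreasing_is_cvgn.
  apply/nonincreasing_seqP => n; rewrite !fE seriesSr.
  have := metric_triangle p (U (z n)) (z n.+1).
  have := U_nonexp p (z n); rewrite Up (metric_sym (U (z n))).
  have := hz n; lra.
exists (- limn (series e)) => _ [n _ <-]; rewrite fE.
have := series_le n; have := mdist_ge0 p (z n); lra.
Qed.

Lemma inexact_orbit_bounded p : Fix U p -> bounded_subset (range z).
Proof.
move=> Up; apply/(bounded_subset_rangeP z p).
exists (mdist p (z 0%N) + limn (series e)) => n.
have := inexact_orbit_shadow 0 n; rewrite add0n (metric_sym (z n)).
have Upn : iter n U p = p by elim: n => //= n ->.
have := nonexpansive_iter n p (z 0%N); rewrite Upn.
have := metric_triangle p (iter n U (z 0%N)) (z n).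
have := series_le n; have := series_ge0 0; lra.
Qed.

End inexact_orbits.

(* For bounded [z] this is the real number [limsup_n (mdist p (z n))]. *)
Definition asymptotic_radius {R : realType} {X : metricType R} (z : nat -> X)
    (p : X) : R :=
  inf [set c : R | \forall n \near \oo, mdist p (z n) <= c].

(** * Asymptotic radii; existence and uniqueness of asymptotic centers *)

Section asymptotic_radius.
Context {R : realType} {X : metricType R}.
Variable z : nat -> X.
Implicit Types p q : X.
Local Notation r := (asymptotic_radius z).

Let r_has_lbound p :
  has_lbound [set c : R | \forall n \near \oo, mdist p (z n) <= c].
Proof.
by exists 0 => c [N _ /(_ N (leqnn N))]; apply: le_trans; exact: mdist_ge0.
Qed.

Lemma asymptotic_radius_le p c :
  (\forall n \near \oo, mdist p (z n) <= c) -> r p <= c.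
Proof. exact: ge_inf. Qed.

Lemma cvg_asymptotic_radius p l :
  mdist p (z n) @[n --> \oo] --> (l : R) -> r p = l.
Proof.
move=> zl; have above eta : 0 < eta -> \forall n \near \oo, mdist p (z n) <= l + eta.
  move=> eta0; have /cvgrPdist_le/(_ _ eta0) := zl; apply: filterS => n /=.
  by rewrite distrC ler_distl => /andP[].
apply/eqP; rewrite eq_le; apply/andP; split.
  by apply/ler_addgt0Pr => eta eta0; apply: asymptotic_radius_le; exact: above.
apply: lb_le_inf; first by exists (l + 1); apply: above.
move=> c hc; rewrite -(cvg_lim _ zl) //.
by apply: limr_le => //; exact: cvgP zl.
Qed.

Hypothesis z_bounded : bounded_subset (range z).

Let r_nonempty p :
  [set c : R | \forall n \near \oo, mdist p (z n) <= c] !=set0.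
Proof.
have [M hM] := (bounded_subset_rangeP z p).1 z_bounded.
by exists M; exact: nearW.
Qed.

Lemma asymptotic_radius_lt p c :
  r p < c -> \forall n \near \oo, mdist p (z n) <= c.
Proof.
move=> /(inf_lt (r_nonempty p))[b hb bc]; apply: filterS hb => n hn.
exact: le_trans hn (ltW bc).
Qed.

Lemma asymptotic_radius_ge0 p : 0 <= r p.
Proof.
apply: lb_le_inf => // c [N _ /(_ N (leqnn N))]; apply: le_trans.
exact: mdist_ge0.
Qed.

Lemma asymptotic_radius_lipschitz p q : r p <= r q + mdist p q.
Proof.
apply/ler_addgt0Pr => eta eta0; apply: asymptotic_radius_le.
have : r q < r q + eta by rewrite ltrDl.
move=> /asymptotic_radius_lt; apply: filterS => n hn.
have := metric_triangle p q (z n); lra.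
Qed.

(** The limsup is an infimum of suprema over the neighborhoods [V] of infinity. An eventual bound
    yields such a [V]; conversely each [V] contains a tail, so its supremum is not [-oo] and, if
    finite, is an eventual bound. *)
Lemma limn_esup_asymptotic_radius p :
  limn_esup (fun n => (mdist p (z n))%:E) = (r p)%:E.
Proof.
apply/eqP; rewrite eq_le; apply/andP; split.
  apply/lee_addgt0Pr => eta eta0; rewrite -EFinD.
  have : r p < r p + eta by rewrite ltrDl.
  move=> /asymptotic_radius_lt hn.
  pose V := [set n | mdist p (z n) <= r p + eta].
  apply: ge_ereal_inf; exists (ereal_sup [set (mdist p (z n))%:E | n in V]).
    by exists V.
  by apply: ge_ereal_sup => _ [n /= hn' <-]; rewrite lee_fin.
apply: le_ereal_inf_tmp => _ [V [N _ NV] <-].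
have supV n : (N <= n)%N ->
    ((mdist p (z n))%:E <= ereal_sup [set (mdist p (z x))%:E | x in V])%E.
  by move=> Nn; apply: ereal_sup_ubound; exists n => //; exact: NV.
case: ereal_sup supV => [c| |] supV; [|by rewrite leey|by have := supV N (leqnn N)].
rewrite lee_fin; apply: asymptotic_radius_le.
by exists N.
Qed.

Lemma asymptotic_centerP p :
  asymptotic_center z p <-> forall q, r p <= r q.
Proof.
rewrite /asymptotic_center limn_esup_asymptotic_radius; split=> [h q|h].
  rewrite -lee_fin h; apply: ereal_inf_lbound; exists q => //.
  exact: limn_esup_asymptotic_radius.
apply/eqP; rewrite eq_le; apply/andP; split.
  apply: le_ereal_inf_tmp => _ [q _ <-].
  by rewrite limn_esup_asymptotic_radius lee_fin.
apply: ereal_inf_lbound; exists p => //.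
exact: limn_esup_asymptotic_radius.
Qed.

Hypothesis hX : CAT0 X.

(** The midpoint [s] of [p] and [q] eventually satisfies [mdist s (z n) ^+ 2 <= c ^+ 2 - mdist p q
    ^+ 2 / 4], while its radius is at least [m]. Near-minimizers of the radius are thus close
    together, which serves both uniqueness and existence. *)
Lemma CAT0_asymptotic_radius_gap p q (m c : R) : 0 <= m ->
  (forall s, m <= r s) -> r p < c -> r q < c ->
  mdist p q ^+ 2 <= 4 * (c ^+ 2 - m ^+ 2).
Proof.
move=> m0 hm rp rq.
have h01 : 0 <= (2^-1 : R) <= 1 by lra.
have [s hs] := CAT0_geodesic_point hX p q h01.
pose v := c ^+ 2 - mdist p q ^+ 2 / 4.
have hv : \forall n \near \oo, mdist s (z n) ^+ 2 <= v.
  near=> n.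
  have cp : mdist p (z n) <= c by near: n; exact: asymptotic_radius_lt.
  have cq : mdist q (z n) <= c by near: n; exact: asymptotic_radius_lt.
  have := hs (z n); rewrite !(metric_sym (z n)).
  have c0 : 0 <= c by apply: le_trans cp; exact: mdist_ge0.
  have : mdist p (z n) ^+ 2 <= c ^+ 2 by rewrite ler_pXn2r ?nnegrE ?mdist_ge0.
  have : mdist q (z n) ^+ 2 <= c ^+ 2 by rewrite ler_pXn2r ?nnegrE ?mdist_ge0.
  rewrite /v; lra.
have v0 : 0 <= v by case: hv => N _ /(_ N (leqnn N)); apply: le_trans; exact: sqr_ge0.
have mv : m <= Num.sqrt v.
  apply: le_trans (hm s) _; apply: asymptotic_radius_le.
  apply: filterS hv => n hn.
  by rewrite -(@ger0_norm _ (mdist s (z n))) ?mdist_ge0 // -sqrtr_sqr ler_wsqrtr.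
have : m ^+ 2 <= Num.sqrt v ^+ 2 by rewrite ler_pXn2r ?nnegrE ?sqrtr_ge0.
rewrite sqr_sqrtr // /v; lra.
Unshelve. all: by end_near. Qed.

Lemma CAT0_asymptotic_center_uniq p q :
  (forall s, r p <= r s) -> (forall s, r q <= r s) -> p = q.
Proof.
move=> hp hq; apply: mdist_positivity; apply/eqP; rewrite -sqrf_eq0 eq_le.
rewrite sqr_ge0 andbT; apply/ler_addgt0Pr => eta eta0; rewrite add0r.
have m0 := asymptotic_radius_ge0 p.
(* For [m = r p] and [c = r p + h] the gap bound is [h * (8 * r p + 4 * h)], at most [eta] for the
   [h] below; the summand [eta] in its denominator ensures [h <= 1]. *)
have k0 : 0 < 8 * r p + 4 + eta by lra.
pose h := eta / (8 * r p + 4 + eta).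
have h0 : 0 < h by rewrite divr_gt0.
have h1 : h <= 1 by rewrite ler_pdivrMr //; lra.
have hk : h * (8 * r p + 4 + eta) = eta by rewrite divfK // gt_eqF.
have rp : r p < r p + h by rewrite ltrDl.
have rq : r q < r p + h by exact: le_lt_trans (hq p) rp.
have := CAT0_asymptotic_radius_gap m0 hp rp rq; nra.
Qed.

End asymptotic_radius.

Lemma asymptotic_radius_mdist_le {R : realType} {X : metricType R}
    (z w : nat -> X) (p q : X) (e : nat -> R) :
  bounded_subset (range z) ->
  (forall n, mdist q (w n) <= mdist p (z n) + e n) ->
  e @ \oo --> (0 : R) -> asymptotic_radius w q <= asymptotic_radius z p.
Proof.
move=> bz h e0; apply/ler_addgt0Pr => eta eta0.
have eta2 : 0 < eta / 2 by rewrite divr_gt0.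
have rp : asymptotic_radius z p < asymptotic_radius z p + eta / 2.
  by rewrite ltrDl.
apply: asymptotic_radius_le; near=> n.
have h1 : mdist p (z n) <= asymptotic_radius z p + eta / 2.
  by near: n; exact: asymptotic_radius_lt.
have h2 : `|0 - e n| <= eta / 2.
  by near: n; have /cvgrPdist_le/(_ _ eta2) := e0.
rewrite sub0r normrN in h2.
by have := h n; have := ler_norm (e n); lra.
Unshelve. all: by end_near. Qed.

(** The gap bound makes a minimizing sequence of the radius Cauchy; since the radius is 1-Lipschitz,
    the limit attains the infimum. *)
Lemma CAT0_asymptotic_center_exists {R : realType} {X : completeMetricType R}
    (z : nat -> X) : CAT0 X -> bounded_subset (range z) ->
  exists p, forall s, asymptotic_radius z p <= asymptotic_radius z s.
Proof.
move=> hX bz; set r := asymptotic_radius z.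
have r0 p : 0 <= r p by exact: asymptotic_radius_ge0.
pose m := inf (range r).
have rlb : has_lbound (range r) by exists 0 => _ [p _ <-].
have rne : range r !=set0 by exists (r (z 0%N)); exists (z 0%N).
have hm s : m <= r s by apply: ge_inf => //; exists s.
have m0 : 0 <= m by apply: lb_le_inf => // _ [p _ <-].
have /choice[u hu] : forall i : nat, exists p, r p < m + i.+1%:R^-1.
  move=> i; have : m < m + i.+1%:R^-1 by rewrite ltrDl invr_gt0.
  by move=> /(inf_lt rne)[_ [p _ <-] hp]; exists p.
(* With [h = N.+1%:R^-1 <= 1], [4 * ((m + h) ^+ 2 - m ^+ 2) = h * (8 * m + 4 * h)]. *)
have gap N i : (N <= i)%N ->
    mdist (u N) (u i) ^+ 2 <= N.+1%:R^-1 * (8 * m + 4).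
  move=> Ni; have hi : r (u i) < m + N.+1%:R^-1.
    apply: lt_le_trans (hu i) _; rewrite lerD2l lef_pV2 ?posrE //.
    by rewrite ler_nat.
  have := CAT0_asymptotic_radius_gap bz hX m0 hm (hu N) hi.
  have : 0 <= (N.+1%:R^-1 : R) by rewrite invr_ge0.
  have : (N.+1%:R^-1 : R) <= 1 by rewrite invf_le1 ?ler1n.
  move: (N.+1%:R^-1) => h h1 h0; nra.
have ucauchy : cauchy (u @ \oo).
  apply: cauchy_exP => eps eps0.
  have k0 : 0 < 8 * m + 4 by lra.
  have e0 : 0 < eps ^+ 2 / (8 * m + 4) by rewrite divr_gt0 ?exprn_gt0.
  have [N _ /(_ N (leqnn N)) /= hN] := near_infty_natSinv_lt (PosNum e0).
  exists (u N); exists N => // i /= Ni; rewrite ballEmdist /=.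
  rewrite -(ltr_pXn2r (_ : (0 < 2)%N)) ?nnegrE ?mdist_ge0 ?ltW //.
  by apply: le_lt_trans (gap N i Ni) _; rewrite -ltr_pdivlMr.
have /cauchy_cvg up := ucauchy.
exists (lim (u @ \oo)) => s; apply: le_trans (hm s).
apply/ler_addgt0Pr => eta eta0.
have eta2 : 0 < eta / 2 by rewrite divr_gt0.
pose l : X := lim (u @ \oo); rewrite -/l in up *.
have h1 : \forall n \near \oo, mdist l (u n) <= eta / 2.
  by have /metricType_numDomainType.cvgrPdist_le/(_ _ eta2) := up.
have h2 : \forall n \near \oo, n.+1%:R^-1 < eta / 2.
  exact: near_infty_natSinv_lt (PosNum eta2).
near \oo => n.
have : mdist l (u n) <= eta / 2 by near: n.
have : n.+1%:R^-1 < eta / 2 by near: n.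
have := hu n; have := asymptotic_radius_lipschitz bz l (u n).
rewrite -/r; move: (mdist l (u n)) (r (u n)) (r l) (n.+1%:R^-1) => D r1 r2 h.
lra.
Unshelve. all: by end_near. Qed.

(** * Fixed points and Delta-convergence for asymptotically regular sequences *)

Section regular_sequences.
Context {R : realType} {X : completeMetricType R}.
Hypothesis hX : CAT0 X.
Variable U : X -> X.
Hypothesis U_nonexp : forall p q : X, mdist (U p) (U q) <= mdist p q.

(** By regularity the radius at [U p] is no larger than at [p], so [U p] is a center too and
    uniqueness applies. *)
Lemma regular_center_fixed (z : nat -> X) (p : X) :
  bounded_subset (range z) ->
  mdist (z n) (U (z n)) @[n --> \oo] --> (0 : R) ->
  (forall s, asymptotic_radius z p <= asymptotic_radius z s) -> Fix U p.
Proof.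
move=> bz zU hp; apply: (CAT0_asymptotic_center_uniq bz hX _ hp) => s.
apply: le_trans (hp s).
apply: asymptotic_radius_mdist_le zU => // n.
have := metric_triangle (U p) (U (z n)) (z n).
by have := U_nonexp p (z n); rewrite (metric_sym (U (z n))); lra.
Qed.

(* Opial's argument: the distance to a fixed point converges, so it has the
   same limit along every subsequence, and all subsequences share one center. *)
Lemma regular_fejer_Delta_cvg (z : nat -> X) : bounded_subset (range z) ->
  mdist (z n) (U (z n)) @[n --> \oo] --> (0 : R) ->
  (forall p, Fix U p -> cvgn (fun n => mdist p (z n))) ->
  exists2 u, Fix U u & Delta_cvg z u.
Proof.
move=> bz zU zF; have [u hu] := CAT0_asymptotic_center_exists hX bz.
have Uu := regular_center_fixed bz zU hu.
exists u => //; split=> // phi hphi; have phioo := increasing_seq_cvg_infty hphi.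
have bphi : bounded_subset (range (z \o phi)).
  case: bz => M hM; exists M => _ _ [i _ <-] [j _ <-].
  by apply: hM; [exists (phi i)|exists (phi j)].
have rphi p : Fix U p -> asymptotic_radius (z \o phi) p = asymptotic_radius z p.
  move=> /zF zp; rewrite (cvg_asymptotic_radius zp).
  by apply: cvg_asymptotic_radius; exact: cvg_comp phioo zp.
have [c hc] := CAT0_asymptotic_center_exists hX bphi.
have Uc : Fix U c.
  by apply: regular_center_fixed bphi _ hc; exact: cvg_comp phioo zU.
(* Both points are fixed, so their radii along [phi] are those along [z]; hence [c] also minimizes
   the radius of [z]. *)
have cu : c = u.
  apply: (CAT0_asymptotic_center_uniq bz hX) => // s.
  by apply: le_trans (hu s); rewrite -!rphi.
rewrite {}cu in hc; apply/seteqP; split=> p.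
  move=> /(asymptotic_centerP bphi) hp.
  exact: (CAT0_asymptotic_center_uniq bphi hX).
by move=> ->; apply/asymptotic_centerP.
Qed.

Lemma Delta_cvg_center (z : nat -> X) (u : X) : Delta_cvg z u ->
  forall s, asymptotic_radius z u <= asymptotic_radius z s.
Proof.
move=> [bz hu]; apply/(asymptotic_centerP bz).
by have -> : asymptotic_center z = [set u] := hu id (fun _ _ => erefl).
Qed.

(** The limit [l] has radius 0 along the subsequence, so it is a center there and a fixed point. The
    distances from [l] to all of [z] therefore converge, necessarily to 0, and [l] is the center
    [u]. *)
Lemma Delta_cvg_subseq_cvg (z : nat -> X) (phi : nat -> nat) (u l : X) :
  increasing_seq phi -> Delta_cvg z u ->
  mdist (z n) (U (z n)) @[n --> \oo] --> (0 : R) ->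
  (forall p, Fix U p -> cvgn (fun n => mdist p (z n))) ->
  z \o phi @ \oo --> l -> z @ \oo --> u.
Proof.
move=> hphi zu zU zF zl; have phioo := increasing_seq_cvg_infty hphi.
have bphi : bounded_subset (range (z \o phi)).
  case: zu.1 => M hM; exists M => _ _ [i _ <-] [j _ <-].
  by apply: hM; [exists (phi i)|exists (phi j)].
have dl : mdist l ((z \o phi) n) @[n --> \oo] --> (0 : R).
  exact/cvg_mdist0.
have Ul : Fix U l.
  apply: (regular_center_fixed bphi); first exact: cvg_comp phioo zU.
  by move=> s; rewrite (cvg_asymptotic_radius dl); exact: asymptotic_radius_ge0.
have zl0 : mdist l (z n) @[n --> \oo] --> (0 : R).
  have zlc := zF l Ul.
  have sub : mdist l ((z \o phi) n) @[n --> \oo] --> limn (fun n => mdist l (z n)).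
    exact: cvg_comp phioo zlc.
  by rewrite -(cvg_unique _ sub dl).
have -> : u = l.
  apply: (CAT0_asymptotic_center_uniq zu.1 hX); first exact: Delta_cvg_center.
  move=> s; rewrite (cvg_asymptotic_radius zl0).
  exact: asymptotic_radius_ge0 zu.1 s.
exact/cvg_mdist0.
Qed.

End regular_sequences.

(** * Alternating two (P2) maps with summable errors *)

Lemma is_cvg_series_shift {R : realType} (e : nat -> R) :
  cvgn (series e) -> cvgn (series (fun n => e n.+1)).
Proof.
move=> ce; have -> : series (fun n => e n.+1) =
    (fun n => series e n.+1) - cst (e 0%N).
  by apply/funext => n; rewrite !fctE /series /= big_nat_recl // addrC addKr.
apply: is_cvgB; last exact: is_cvg_cst.
have cS : series e n.+1 @[n --> \oo] --> limn (series e).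
  by rewrite (@cvg_shiftS _ (series e)).
exact: cvgP cS.
Qed.

(** Since [T2] is nonexpansive, one round is a single inexact step of [T2 \o T1] with error
    [eps n + delta n]. Only [x] is treated, so that exchanging the roles of the maps covers [y]. *)
Lemma inexact_P2_alternation {R : realType} {X : completeMetricType R}
    (T1 T2 : X -> X) (eps delta : nat -> R) (x y : nat -> X) :
  CAT0 X -> property_P2 T1 -> property_P2 T2 ->
  (forall n, 0 <= eps n) -> (forall n, 0 <= delta n) ->
  cvgn (series eps) -> cvgn (series delta) ->
  (forall n, mdist (y n) (T1 (x n)) <= eps n) ->
  (forall n, mdist (x n.+1) (T2 (y n)) <= delta n) ->
  [/\ bounded_subset (range x) <-> Fix (T2 \o T1) !=set0,
      bounded_subset (range x) ->
        mdist (x n) (T2 (T1 (x n))) @[n --> \oo] --> (0 : R),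
      forall p, Fix (T2 \o T1) p -> cvgn (fun n => mdist p (x n)) &
      Fix (T2 \o T1) !=set0 -> exists2 u, Fix (T2 \o T1) u & Delta_cvg x u].
Proof.
move=> hX hT1 hT2 eps0 delta0 ceps cdelta hy hx.
have ne1 := P2_nonexpansive hX hT1; have ne2 := P2_nonexpansive hX hT2.
pose e := eps + delta.
have e0 n : 0 <= e n by exact: addr_ge0.
have ce : cvgn (series e) by exact: is_cvg_seriesD.
have neU p q : mdist ((T2 \o T1) p) ((T2 \o T1) q) <= mdist p q.
  by exact: le_trans (ne2 _ _) (ne1 _ _).
have midU p q : 2 * mdist ((T2 \o T1) p) ((T2 \o T1) q) <=
    mdist p ((T2 \o T1) q) + mdist q ((T2 \o T1) p).
  exact: (P2_comp hX hT1 hT2).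
have hz n : mdist (x n.+1) ((T2 \o T1) (x n)) <= e n.
  have := metric_triangle (x n.+1) (T2 (y n)) (T2 (T1 (x n))).
  have := ne2 (y n) (T1 (x n)); have := hy n; have := hx n.
  by rewrite /e !fctE /=; lra.
have reg := inexact_orbit_regular neU midU e0 ce hz.
have fej := inexact_orbit_fejer neU e0 ce hz.
have bnd p : Fix (T2 \o T1) p -> bounded_subset (range x).
  exact: (inexact_orbit_bounded neU e0 ce hz).
split=> //; last first.
  move=> [p /bnd bx].
  exact: (regular_fejer_Delta_cvg hX neU bx (reg bx) fej).
split=> [bx|[p /bnd //]].
have [p hp] := CAT0_asymptotic_center_exists hX bx.
by exists p; exact: (regular_center_fixed hX neU bx (reg bx) hp).
Qed.

Theorem theorem4p4 (R : realType) (X : completeMetricType R) (T1 T2 : X -> X)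
  (eps delta : nat -> R) (x0 : X) (x y : nat -> X)
  (hX : CAT0 X) (hT1 : property_P2 T1) (hT2 : property_P2 T2)
  (eps_ge0 : forall n, 0 <= eps n) (delta_ge0 : forall n, 0 <= delta n)
  (eps_sum : (\sum_(0 <= n <oo) (eps n)%:E < +oo)%E)
  (delta_sum : (\sum_(0 <= n <oo) (delta n)%:E < +oo)%E)
  (hx0 : x 0%N = x0)
  (hy : forall n, mdist (y n) (T1 (x n)) <= eps n)
  (hx : forall n, mdist (x n.+1) (T2 (y n)) <= delta n) :
  (Fix (T2 \o T1) = set0 ->
     ~ bounded_subset (range x) /\ ~ bounded_subset (range y)) /\
  (Fix (T2 \o T1) !=set0 ->
     exists2 u : X, Fix (T2 \o T1) u &
       [/\ Delta_cvg x u, Delta_cvg y (T1 u) &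
           boundedly_compact (range T1) \/ boundedly_compact (range T2) ->
             (x @ \oo --> u) /\ (y @ \oo --> T1 u)]).
Proof.
have ne1 := P2_nonexpansive hX hT1; have ne2 := P2_nonexpansive hX hT2.
have neU p q : mdist ((T2 \o T1) p) ((T2 \o T1) q) <= mdist p q.
  by exact: le_trans (ne2 _ _) (ne1 _ _).
have ceps := nnseries_is_cvg eps_ge0 eps_sum.
have cdelta := nnseries_is_cvg delta_ge0 delta_sum.
have eps_cvg0 := cvg_series_cvg_0 ceps.
have delta_cvg0 := cvg_series_cvg_0 cdelta.
have [hbx regx fejx Dx] :=
  inexact_P2_alternation hX hT1 hT2 eps_ge0 delta_ge0 ceps cdelta hy hx.
(* Here [y] is the main sequence and [x n.+1] the intermediate one, so the errors are [delta n]
   followed by [eps n.+1]. *)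
have [hby _ _ Dy] := inexact_P2_alternation hX hT2 hT1 delta_ge0
  (fun n => eps_ge0 n.+1) cdelta (is_cvg_series_shift ceps)
  hx (fun n => hy n.+1).
split=> [F0|F].
  split=> [/hbx|/hby [q hq]]; first by rewrite F0 => /set0P/eqP.
  have : Fix (T2 \o T1) (T2 q) by rewrite /Fix /= (hq : T1 (T2 q) = q).
  by rewrite F0.
have [u Uu xu] := Dx F; exists u => //.
have F' : Fix (T1 \o T2) !=set0.
  by case: F => p Up; exists (T1 p); rewrite /Fix /= (Up : T2 (T1 p) = p).
have [v Vv yv] := Dy F'.
(* [d(y_n, T1 u)] is asymptotically at most [d(x_n, u)], and [d(x_n, T2 v)] at
   most [d(y_n, v)], so [T1 u] is also an asymptotic center of [y]. *)
have limy p : Fix (T2 \o T1) p ->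
    asymptotic_radius y (T1 p) <= asymptotic_radius x p.
  move=> Up; apply: (asymptotic_radius_mdist_le xu.1 _ eps_cvg0) => n.
  have := metric_triangle (T1 p) (T1 (x n)) (y n); have := ne1 p (x n).
  by have := hy n; rewrite (metric_sym (y n)); lra.
have limx q : Fix (T1 \o T2) q ->
    asymptotic_radius x (T2 q) <= asymptotic_radius y q.
  move=> Vq; have Uq : Fix (T2 \o T1) (T2 q).
    by rewrite /Fix /= (Vq : T1 (T2 q) = q).
  rewrite (cvg_asymptotic_radius (fejx _ Uq)).
  (* The estimate from [y n] controls [x n.+1]; the shift leaves the radius unchanged because the
     distances to the fixed point [T2 q] converge. *)
  have xS : mdist (T2 q) (x n.+1) @[n --> \oo] -->
      limn (fun n => mdist (T2 q) (x n)).
    by rewrite (@cvg_shiftS _ (fun n => mdist (T2 q) (x n))); exact: fejx.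
  rewrite -(@cvg_asymptotic_radius _ _ (fun n => x n.+1) _ _ xS).
  apply: (asymptotic_radius_mdist_le yv.1 _ delta_cvg0) => n.
  have := metric_triangle (T2 q) (T2 (y n)) (x n.+1); have := ne2 q (y n).
  by have := hx n; rewrite (metric_sym (x n.+1)); lra.
(* Write [r_x] and [r_y] for the radii. Then [r_y (T1 u) <= r_x u <= r_x (T2 v) <= r_y v], and [v]
   minimizes [r_y]. *)
have vE : v = T1 u.
  apply: (CAT0_asymptotic_center_uniq yv.1 hX); first exact: Delta_cvg_center.
  move=> s; apply: le_trans (limy u Uu) _.
  apply: le_trans (Delta_cvg_center xu (T2 v)) _.
  apply: le_trans (limx v Vv) _; exact: Delta_cvg_center.
rewrite {}vE in yv.
split=> // hc.
have bS (T : X -> X) (z : nat -> X) :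
    (forall p q, mdist (T p) (T q) <= mdist p q) ->
    bounded_subset (range z) -> bounded_subset (range (T \o z)).
  move=> neT [M hM]; exists M => _ _ [i _ <-] [j _ <-] /=.
  by apply: le_trans (neT _ _) _; apply: hM; [exists i | exists j].
(* If [T1 (x (phi n))] tends to [l], so does [y (phi n)], and [x (phi n).+1] tends to [T2 l]. If
   [T2 (y (phi n))] tends to [l], so does [x (phi n).+1]. Either way the subsequence of [x] is
   indexed by [S \o phi]. *)
have [phi hphi [l xl]] : exists2 phi : nat -> nat, increasing_seq phi &
    exists l : X, x \o phi @ \oo --> l.
  have incrS (phi : nat -> nat) :
    increasing_seq phi -> increasing_seq (S \o phi) by move=> hp i j; exact: hp.
  case: hc => hc.
    have [|phi hphi [l _ hl]] := hc (T1 \o x) _ (bS _ _ ne1 xu.1).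
      by move=> n; exists (x n).
    exists (S \o phi); [exact: incrS | exists (T2 l)].
    have e0 : ((eps \o phi) + (delta \o phi)) n @[n --> \oo] --> (0 : R).
      have phioo := increasing_seq_cvg_infty hphi.
      have ep : eps \o phi @ \oo --> (0 : R) by exact: cvg_comp phioo eps_cvg0.
      have dp : delta \o phi @ \oo --> (0 : R).
        exact: cvg_comp phioo delta_cvg0.
      by rewrite -[0]addr0; exact: cvgD ep dp.
    apply: (cvg_mdist_le _ e0 hl) => n; rewrite !fctE /=.
    have := metric_triangle (T2 l) (T2 (y (phi n))) (x (phi n).+1).
    have := ne2 l (y (phi n)).
    have := metric_triangle l (T1 (x (phi n))) (y (phi n)).
    have := hx (phi n); rewrite (metric_sym (x (phi n).+1)).
    by have := hy (phi n); rewrite (metric_sym (y (phi n))); lra.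
  have [|phi hphi [l _ hl]] := hc (T2 \o y) _ (bS _ _ ne2 yv.1).
    by move=> n; exists (y n).
  exists (S \o phi); [exact: incrS | exists l].
  apply: (cvg_mdist_le _ _ hl).
    2: exact: cvg_comp (increasing_seq_cvg_infty hphi) delta_cvg0.
  move=> n /=; have := metric_triangle l (T2 (y (phi n))) (x (phi n).+1).
  by have := hx (phi n); rewrite (metric_sym (x (phi n).+1)); lra.
have xcvg : x @ \oo --> u.
  exact: (Delta_cvg_subseq_cvg hX neU hphi xu (regx xu.1) fejx xl).
split=> //; apply: (cvg_mdist_le _ eps_cvg0 xcvg) => n.
have := metric_triangle (T1 u) (T1 (x n)) (y n); have := ne1 u (x n).
by have := hy n; rewrite (metric_sym (y n)); lra.
Qed.
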